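(* Let $X, Y\in\mathbb{C}^{n\times m}$ and let $X = RQ$ be an economy RQ decomposition, where $R\in\mathbb{C}^{n\times n}$ is upper triangular and $Q\in\mathbb{C}^{n\times m}$ satisfies $QQ^* = I$. For $1\le i\le n$ let $R_i = R_{i:n,i:n}$ be the bottom right $(n-i+1)\times(n-i+1)$ block of $R$. Then the solution of smallest Frobenius norm of the upper triangular Procrustes problem $$\min\{\|Y - AX\|_F : A\in\mathbb{C}^{n\times n}\text{ upper triangular}\}$$ is the upper triangular matrix $A$ with rows $$A_{i,i:n} = (YQ^* )_{i,i:n}\,R_i^{\dagger},\qquad 1\le i\le n.$$
   Context: $\|\cdot\|_F$ is the Frobenius norm, $*$ denotes conjugate transpose, $\dagger$ is the Moore--Penrose pseudoinverse, and $M_{i,i:n}$ denotes the row vector $(M_{i,i},\dots,M_{i,n})$ of a matrix $M$. *)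

(* Defs.v *)
From mathcomp Require Import all_boot all_order all_algebra.
From mathcomp Require Import spectral complex.
From mathcomp Require Import reals.

Set Implicit Arguments.
Unset Strict Implicit.
Unset Printing Implicit Defensive.

Import Order.TTheory GRing.Theory Num.Theory.
Local Open Scope ring_scope.
Local Open Scope sesquilinear_scope.

(* In MathComp, [is_trig_mx] means lower triangular. *)
Definition upper_trig_mx (T : nmodType) (n : nat) (A : 'M[T]_n) : bool :=
  is_trig_mx A^T.

Lemma upper_trig_mxP (T : nmodType) (n : nat) (A : 'M[T]_n) :
  reflect (forall i j : 'I_n, (j < i)%N -> A i j = 0) (upper_trig_mx A).
Proof.
apply: (iffP is_trig_mxP) => [trA i j ltji | trA i j ltij].
  by have := trA j i ltji; rewrite mxE.
by rewrite mxE trA.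
Qed.

(* A sum of squared moduli is a nonnegative real, so [sqrtC] is the real square
   root here and the order of [C] compares Frobenius norms as real numbers. *)
Definition frob_norm (C : numClosedFieldType) (m n : nat) (A : 'M[C]_(m, n)) : C :=
  sqrtC (\sum_(i < m) \sum_(j < n) `|A i j| ^+ 2).

Section MoorePenrose.
Variable C : numClosedFieldType.

(* The four Penrose equations. *)
Definition penrose (m n : nat) (A : 'M[C]_(m, n)) (B : 'M[C]_(n, m)) : bool :=
  [&& A *m B *m A == A, B *m A *m B == B,
      (A *m B)^t* == A *m B & (B *m A)^t* == B *m A].

Lemma mulmx_trC (m n p : nat) (A : 'M[C]_(m, n)) (B : 'M[C]_(n, p)) :
  (A *m B)^t* = B^t* *m A^t*.
Proof. by rewrite trmx_mul map_mxM. Qed.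

Lemma gram_unitmx (r n : nat) (G : 'M[C]_(r, n)) :
  row_free G -> G *m G^t* \in unitmx.
Proof.
move=> Gfree; rewrite -row_free_unit; apply: inj_row_free => v v0.
have vG0 : v *m G = 0.
  apply/eqP; apply: contraT => /dotmx_is_dotmx.
  by rewrite dotmxE mulmx_trC !mulmxA -(mulmxA v) v0 mul0mx mxE ltxx.
by apply: (row_free_inj Gfree); rewrite vG0 mul0mx.
Qed.

Lemma penrose_full_rank (m r n : nat) (F : 'M[C]_(m, r)) (G : 'M[C]_(r, n)) :
    row_full F -> row_free G ->
  penrose (F *m G)
    (G^t* *m invmx (G *m G^t*) *m invmx (F^t* *m F) *m F^t*).
Proof.
move=> Ffull Gfree; have uS := gram_unitmx Gfree.
have uP : F^t* *m F \in unitmx.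
  rewrite -{2}(trmxCK F); apply: gram_unitmx.
  by rewrite /row_free mxrank_map mxrank_tr.
have invC p (M : 'M[C]_p) : M \in unitmx -> M^t* = M -> (invmx M)^t* = invmx M.
  by move=> uM hM; rewrite trmx_inv map_invmx hM.
have hS : (invmx (G *m G^t*))^t* = invmx (G *m G^t*).
  by apply: invC; rewrite // mulmx_trC trmxCK.
have hP : (invmx (F^t* *m F))^t* = invmx (F^t* *m F).
  by apply: invC; rewrite // mulmx_trC trmxCK.
have SS' := mulmxV uS; have P'P := mulVmx uP.
set S' := invmx (G *m _) in hS SS' *; set P' := invmx (_ *m F) in hP P'P *.
set B := _ *m F^t*.
have AB : F *m G *m B = F *m P' *m F^t*.
  by rewrite /B -!mulmxA (mulmxA G) (mulmxA (G *m _)) SS' mul1mx.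
have BA : B *m (F *m G) = G^t* *m S' *m G.
  by rewrite /B -!mulmxA (mulmxA _ F G) (mulmxA P') P'P mul1mx.
apply/and4P; split; apply/eqP.
- by rewrite AB -!mulmxA (mulmxA _ F G) (mulmxA P') P'P mul1mx.
- by rewrite BA /B -!mulmxA (mulmxA G) (mulmxA (G *m _)) SS' mul1mx.
- by rewrite AB !mulmx_trC trmxCK hP mulmxA.
- by rewrite BA !mulmx_trC trmxCK hS mulmxA.
Qed.

Lemma penrose_exists (m n : nat) (A : 'M[C]_(m, n)) : exists B, penrose A B.
Proof.
have := penrose_full_rank (col_base_full A) (row_base_free A).
by rewrite mulmx_base => AB; eexists; exact: AB.
Qed.

Lemma penrose_uniq (m n : nat) (A : 'M[C]_(m, n)) (B D : 'M[C]_(n, m)) :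
  penrose A B -> penrose A D -> B = D.
Proof.
move=> /and4P[/eqP aba /eqP bab /eqP ab /eqP ba].
move=> /and4P[/eqP ada /eqP dad /eqP ad /eqP da].
have eAB : A *m B = A *m D.
  rewrite -ab -{1}ada -(mulmxA (A *m D)) mulmx_trC ab ad.
  by rewrite mulmxA aba.
have eBA : B *m A = D *m A.
  rewrite -ba -{1}ada -(mulmxA A) (mulmxA B) mulmx_trC ba da.
  by rewrite -mulmxA (mulmxA A) aba.
by rewrite -bab -mulmxA eAB mulmxA eBA dad.
Qed.

(* Moore-Penrose pseudoinverse. MathComp's [pinvmx] is not it: [pinvmx] is only
   a generalized inverse depending on a choice of bases. *)
Definition mp_pinv (m n : nat) (A : 'M[C]_(m, n)) : 'M[C]_(n, m) :=
  xchoose (penrose_exists A).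

Lemma mp_pinvP (m n : nat) (A : 'M[C]_(m, n)) : penrose A (mp_pinv A).
Proof. exact: xchooseP. Qed.

End MoorePenrose.

Lemma tail_ord_subproof (n : nat) (i : 'I_n) (k : 'I_(n - i)) : (i + k < n)%N.
Proof. by rewrite -ltn_subRL. Qed.

(* The increasing enumeration k |-> i + k of the indices i, ..., n-1; indices
   start at 0, so the tail at i has n - i entries. *)
Definition tail_ord (n : nat) (i : 'I_n) (k : 'I_(n - i)) : 'I_n :=
  Ordinal (tail_ord_subproof k).

Definition trailing_block (T : Type) (n : nat) (M : 'M[T]_n) (i : 'I_n) :
    'M[T]_(n - i) :=
  mxsub (@tail_ord n i) (@tail_ord n i) M.

Definition row_tail (T : Type) (n : nat) (M : 'M[T]_n) (i : 'I_n) :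
    'rV[T]_(n - i) :=
  colsub (@tail_ord n i) (row i M).

Section Procrustes.
Variables (C : numClosedFieldType) (n m : nat).
Implicit Types (X Y : 'M[C]_(n, m)) (A B : 'M[C]_n).

Definition procrustes_solution X Y A : Prop :=
  upper_trig_mx A /\
  forall B, upper_trig_mx B -> frob_norm (Y - A *m X) <= frob_norm (Y - B *m X).

Definition min_norm_procrustes_solution X Y A : Prop :=
  procrustes_solution X Y A /\
  forall B, procrustes_solution X Y B -> frob_norm A <= frob_norm B.

End Procrustes.

(* Main.v *)
Require Import Defs.
From mathcomp Require Import all_boot all_order all_algebra.
From mathcomp Require Import spectral complex.
From mathcomp Require Import reals.

Set Implicit Arguments.
Unset Strict Implicit.
Unset Printing Implicit Defensive.

Import Order.TTheory GRing.Theory Num.Theory.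
Local Open Scope ring_scope.
Local Open Scope sesquilinear_scope.

(** Write [<M, N> = tr (M N^* )]. Let A have the rows given by the
    pseudoinverses and let B be upper triangular, D = A - B. Since D R is upper
    triangular, <Y - A X, D X> splits into the inner products of
    Z_i - Z_i R_i^+ R_i with D_i R_i, where Z_i and D_i are the tails of the
    rows of Y Q^* and D; these vanish by the Penrose equations. Pythagoras
    gives |Y - B X|^2 = |Y - A X|^2 + |D X|^2, so B is a solution exactly when
    D X = 0. Then D_i R_i = 0 for all i, so D is orthogonal to A, and Pythagoras
    again gives |B|^2 = |A|^2 + |D|^2. *)

Lemma upper_trig_mxB (T : zmodType) (n : nat) (A B : 'M[T]_n) :
  upper_trig_mx A -> upper_trig_mx B -> upper_trig_mx (A - B).
Proof.
move=> /upper_trig_mxP uA /upper_trig_mxP uB; apply/upper_trig_mxP => i j ji.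
by rewrite !mxE uA ?uB ?subr0.
Qed.

Lemma upper_trig_mxM (T : pzSemiRingType) (n : nat) (A B : 'M[T]_n) :
  upper_trig_mx A -> upper_trig_mx B -> upper_trig_mx (A *m B).
Proof.
move=> /upper_trig_mxP uA /upper_trig_mxP uB; apply/upper_trig_mxP => i j ji.
rewrite mxE big1 // => k _; have [ki|ik] := ltnP k i; first by rewrite uA ?mul0r.
by rewrite uB ?mulr0 // (leq_trans ji).
Qed.

Lemma tail_ord_inj (n : nat) (i : 'I_n) : injective (@tail_ord n i).
Proof. by move=> k l /(congr1 val) /= /addnI /val_inj. Qed.

Lemma sum_tail_ord (V : nmodType) (n : nat) (i : 'I_n) (F : 'I_n -> V) :
    (forall j : 'I_n, (j < i)%N -> F j = 0) ->
  \sum_j F j = \sum_k F (@tail_ord n i k).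
Proof.
move=> F0; rewrite (bigID (fun j : 'I_n => (i <= j)%N)) /= addrC big1 ?add0r.
  have jP (j : 'I_n) : (i <= j)%N -> (j - i < n - i)%N.
    by move=> ij; rewrite ltn_sub2r.
  (* Since i < n, the range of tail indices is nonempty, which provides the default that [insubd]
     asks for. The inverse j |-> j - i lands in that range when i <= j, so the default is never
     returned there. *)
  have k0 : 'I_(n - i) by exists 0%N; rewrite subn_gt0.
  rewrite (reindex_onto (@tail_ord n i) (fun j => insubd k0 (j - i)%N)) /=.
    apply: eq_bigl => k; rewrite leq_addr /=; apply/eqP/val_inj => /=.
    by rewrite val_insubd addKn ltn_ord.
  by move=> j ij; apply: val_inj; rewrite /= val_insubd jP // subnKC.
by move=> j; rewrite -ltnNge; apply: F0.
Qed.

Lemma row_tail_mulmx (T : pzSemiRingType) (n : nat) (A B : 'M[T]_n) (i : 'I_n) :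
  upper_trig_mx A -> row_tail (A *m B) i = row_tail A i *m trailing_block B i.
Proof.
move=> /upper_trig_mxP uA; apply/rowP => k; rewrite !mxE (@sum_tail_ord _ _ i).
  by apply: eq_bigr => l _; rewrite !mxE.
by move=> j ji; rewrite uA ?mul0r.
Qed.

Lemma row_tailB (T : zmodType) (n : nat) (A B : 'M[T]_n) (i : 'I_n) :
  row_tail (A - B) i = row_tail A i - row_tail B i.
Proof. by apply/rowP => k; rewrite !mxE. Qed.

Lemma exists_row_tail (T : pzSemiRingType) (n : nat)
    (w : forall i : 'I_n, 'rV[T]_(n - i)) :
  exists2 A : 'M[T]_n, upper_trig_mx A & forall i, row_tail A i = w i.
Proof.
(* Multiplying by the rows i, ..., n-1 of the identity pads [w i] with i zeros on the left. *)
exists (\matrix_i (w i *m rowsub (@tail_ord n i) 1%:M)) => [|i].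
  apply/upper_trig_mxP => i j ji; rewrite !mxE big1 // => k _.
  rewrite !mxE -val_eqE /= gtn_eqF ?mulr0 //.
  by rewrite (leq_trans ji) ?leq_addr.
apply/rowP => k; rewrite !mxE (bigD1 k) //= big1 ?addr0 => [|l lk].
  by rewrite !mxE eqxx mulr1.
by rewrite !mxE (inj_eq (@tail_ord_inj _ _)) (negPf lk) mulr0.
Qed.

Section Frobenius.
Variable C : numClosedFieldType.

Definition frob_dot (m n : nat) (A B : 'M[C]_(m, n)) : C := \tr (A *m B^t*).

Lemma frob_dotE (m n : nat) (A B : 'M[C]_(m, n)) :
  frob_dot A B = \sum_i \sum_j A i j * (B i j)^*.
Proof.
by apply: eq_bigr => i _; rewrite mxE; apply: eq_bigr => j _; rewrite !mxE.
Qed.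

Lemma frob_normE (m n : nat) (A : 'M[C]_(m, n)) :
  frob_norm A = sqrtC (frob_dot A A).
Proof.
rewrite frob_dotE; congr sqrtC.
by apply: eq_bigr => i _; apply: eq_bigr => j _; rewrite normCK.
Qed.

Lemma frob_dot_ge0 (m n : nat) (A : 'M[C]_(m, n)) : 0 <= frob_dot A A.
Proof.
rewrite frob_dotE; apply: sumr_ge0 => i _; apply: sumr_ge0 => j _.
exact: mul_conjC_ge0.
Qed.

Lemma frob_dot_eq0 (m n : nat) (A : 'M[C]_(m, n)) : frob_dot A A = 0 -> A = 0.
Proof.
rewrite frob_dotE => /eqP; rewrite psumr_eq0 => [/allP A0|i _]; last first.
  by apply: sumr_ge0 => j _; apply: mul_conjC_ge0.
apply/matrixP => i j; have := A0 i (mem_index_enum i).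
rewrite psumr_eq0 => [/allP /(_ j (mem_index_enum j))|k _].
  by rewrite mul_conjC_eq0 mxE => /eqP.
exact: mul_conjC_ge0.
Qed.

Lemma frob_norm_le (m n p q : nat) (A : 'M[C]_(m, n)) (B : 'M[C]_(p, q)) :
  (frob_norm A <= frob_norm B) = (frob_dot A A <= frob_dot B B).
Proof. by rewrite !frob_normE ler_sqrtC // qualifE /= frob_dot_ge0. Qed.

Lemma frob_dotC (m n : nat) (A B : 'M[C]_(m, n)) :
  frob_dot A B = (frob_dot B A)^*.
Proof.
rewrite !frob_dotE rmorph_sum; apply: eq_bigr => i _; rewrite rmorph_sum.
by apply: eq_bigr => j _; rewrite rmorphM /= conjCK mulrC.
Qed.

Lemma frob_dot_pythagoras (m n : nat) (A B : 'M[C]_(m, n)) :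
  frob_dot A B = 0 -> frob_dot (A + B) (A + B) = frob_dot A A + frob_dot B B.
Proof.
move=> AB; have BA : frob_dot B A = 0 by rewrite frob_dotC AB conjC0.
rewrite /frob_dot linearD map_mxD mulmxDl !mulmxDr !mxtraceD.
by rewrite -!/(frob_dot _ _) AB BA addr0 add0r.
Qed.

(** The zeros of B alone remove the terms left of the diagonal; the first argument will be
    [Y *m Q^t* - A *m R], in general a full matrix. *)
Lemma frob_dot_row_tail (n : nat) (A B : 'M[C]_n) : upper_trig_mx B ->
  frob_dot A B = \sum_i frob_dot (row_tail A i) (row_tail B i).
Proof.
move=> /upper_trig_mxP uB; rewrite frob_dotE; apply: eq_bigr => i _.
rewrite (@sum_tail_ord _ _ i) => [|j ji]; last by rewrite uB // conjC0 mulr0.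
by rewrite frob_dotE big_ord1; apply: eq_bigr => k _; rewrite !mxE.
Qed.

(** Conjugate transpose of A A^+ A = A, with A^+ A Hermitian. It makes z - z A^+ A orthogonal to
    every w A, as the residual tails require. *)
Lemma trC_mulmx_mp_pinv (m n : nat) (A : 'M[C]_(m, n)) :
  A^t* = mp_pinv A *m A *m A^t*.
Proof.
case/and4P: (mp_pinvP A) => /eqP aba _ _ /eqP ba.
by rewrite -ba -mulmx_trC mulmxA aba.
Qed.

(** Conjugate transpose of A^+ A A^+ = A^+, with A A^+ Hermitian. Hence d A = 0 makes d orthogonal
    to every z A^+, which gives minimality of the norm. *)
Lemma mp_pinv_trC_mulmx (m n : nat) (A : 'M[C]_(m, n)) :
  (mp_pinv A)^t* = A *m mp_pinv A *m (mp_pinv A)^t*.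
Proof.
case/and4P: (mp_pinvP A) => _ /eqP bab /eqP ab _.
by rewrite -ab -mulmx_trC mulmxA bab.
Qed.

Section Procrustes.
Variables (n m : nat) (X Y : 'M[C]_(n, m)) (R : 'M[C]_n) (Q : 'M[C]_(n, m)).
Hypotheses (X_RQ : X = R *m Q) (R_upper : upper_trig_mx R).
Hypothesis QQ1 : Q *m Q^t* = 1%:M.
Variable A : 'M[C]_n.
Hypothesis A_upper : upper_trig_mx A.
Hypothesis A_tail : forall i : 'I_n,
  row_tail A i = row_tail (Y *m Q^t*) i *m mp_pinv (trailing_block R i).

Lemma procrustes_residual_orthogonal (D : 'M[C]_n) : upper_trig_mx D ->
  frob_dot (Y - A *m X) (D *m X) = 0.
Proof.
(* The factor Q of D R Q moves to the left argument as Q^*, where Q Q^* = 1 turns A R Q Q^* into A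
   R. *)
move=> uD; transitivity (frob_dot (Y *m Q^t* - A *m R) (D *m R)).
  rewrite /frob_dot X_RQ [D *m (R *m Q)]mulmxA (mulmx_trC _ Q) mulmxA.
  by rewrite mulmxBl -!mulmxA QQ1 mulmx1.
rewrite frob_dot_row_tail ?upper_trig_mxM // big1 // => i _.
rewrite row_tailB !row_tail_mulmx // A_tail /frob_dot mulmx_trC mulmxA mulmxBl.
rewrite {1}(trC_mulmx_mp_pinv (trailing_block R i)) !mulmxA subrr mul0mx.
by rewrite mxtrace0.
Qed.

Lemma procrustes_objective (B : 'M[C]_n) : upper_trig_mx B ->
  frob_dot (Y - B *m X) (Y - B *m X) =
    frob_dot (Y - A *m X) (Y - A *m X) + frob_dot ((A - B) *m X) ((A - B) *m X).
Proof.
move=> uB; rewrite -frob_dot_pythagoras.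
  by rewrite mulmxBl addrA subrK.
by rewrite procrustes_residual_orthogonal ?upper_trig_mxB.
Qed.

Lemma pinv_rows_procrustes_solution : procrustes_solution X Y A.
Proof.
split=> // B uB; rewrite frob_norm_le (procrustes_objective uB).
by rewrite lerDl frob_dot_ge0.
Qed.

Lemma procrustes_solution_norm (B : 'M[C]_n) : procrustes_solution X Y B ->
  frob_dot B B = frob_dot A A + frob_dot (B - A) (B - A).
Proof.
(* Testing the optimality of B against A leaves |(A - B) X|^2 <= 0. *)
case=> uB /(_ A A_upper); rewrite frob_norm_le procrustes_objective // gerDl.
move=> le0; have /frob_dot_eq0 DX0 : frob_dot ((A - B) *m X) ((A - B) *m X) = 0.
  by apply/eqP; rewrite eq_le le0 frob_dot_ge0.
(* R is recovered from X as X Q^*. *)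
have BR : (B - A) *m R = 0.
  rewrite -[R]mulmx1 -QQ1 (mulmxA R) -X_RQ mulmxA -opprB mulNmx DX0.
  by rewrite oppr0 mul0mx.
(* The arguments are swapped so that the tail of B - A ends up directly left of R_i R_i^+, where
   [DR0] applies. *)
rewrite -frob_dot_pythagoras ?(addrC A) ?subrK // frob_dotC.
rewrite frob_dot_row_tail // big1 ?conjC0 // => i _.
have DR0 : row_tail (B - A) i *m trailing_block R i = 0.
  rewrite -row_tail_mulmx ?upper_trig_mxB // BR.
  by apply/rowP => k; rewrite !mxE.
rewrite /frob_dot A_tail mulmx_trC mp_pinv_trC_mulmx !mulmxA DR0.
by rewrite !mul0mx mxtrace0.
Qed.

Lemma pinv_rows_unique_min_norm : unique (min_norm_procrustes_solution X Y) A.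
Proof.
split=> [|B [solB minB]].
  split=> [|B solB]; first exact: pinv_rows_procrustes_solution.
  by rewrite frob_norm_le (procrustes_solution_norm solB) lerDl frob_dot_ge0.
(* A is itself a solution, so |B| <= |A|; with |B|^2 = |A|^2 + |B - A|^2 this forces B = A. *)
have := minB A pinv_rows_procrustes_solution.
rewrite frob_norm_le (procrustes_solution_norm solB) gerDl => le0.
apply/esym/eqP; rewrite -subr_eq0; apply/eqP/frob_dot_eq0/eqP.
by rewrite eq_le le0 frob_dot_ge0.
Qed.

End Procrustes.
End Frobenius.

Theorem mainTheorem5 (K : realType) (n m : nat) (X Y : 'M[K[i]]_(n, m))
    (R : 'M[K[i]]_n) (Q : 'M[K[i]]_(n, m))
    (X_RQ : X = R *m Q) (R_upper : upper_trig_mx R) (QQ1 : Q *m Q^t* = 1%:M) :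
  exists A : 'M[K[i]]_n,
    [/\ upper_trig_mx A,
        forall i : 'I_n,
          row_tail A i = row_tail (Y *m Q^t*) i *m mp_pinv (trailing_block R i)
      & unique (min_norm_procrustes_solution X Y) A].
Proof.
have [A uA tA] := exists_row_tail (fun i : 'I_n =>
  row_tail (Y *m Q^t*) i *m mp_pinv (trailing_block R i)).
by exists A; split=> //; apply: (pinv_rows_unique_min_norm X_RQ R_upper QQ1 uA tA).
Qed.
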